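(* Let $\tau$ be a finite set of proposition symbols, let $s$ be a $\tau$-assignment and let $\varphi,\psi\in\mathrm{PL}[\tau]$ be such that $\neg\varphi\land\psi$ is satisfiable. Assume that $s\vDash\varphi\land\neg\psi$. Let $S_s$ be the set of literals over $\tau$ true in $s$, and let $(\theta,\theta',\chi)$ be an output of the counterfactual difference problem with input $(S_s,\varphi,\psi)$, where $\theta,\theta',\chi$ are in CNF. Then $\theta'\land\chi$ defines a $\tau$-assignment $s'$ such that $s'=s\triangle\lambda$ for some set $\lambda$ of literals which is of minimum cardinality among the sets $\lambda$ of literals satisfying $s\vDash\lambda$ (i.e. $\lambda\subseteq s$) and $s\triangle\lambda\vDash\neg\varphi\land\psi$.
   Context: $\mathrm{PL}[\tau]$ is the set of propositional formulas over $\tau$ given by $\varphi ::= \bot \mid p \mid \neg\varphi \mid \varphi\land\varphi \mid \varphi\lor\varphi$ with $p\in\tau$; $\top:=\neg\bot$. $\vDash$ is classical satisfaction/logical consequence and $\equiv$ logical equivalence; a finite set of formulas is identified with the conjunction of its members. A $\tau$-assignment is a function $s:\tau\to\{0,1\}$; it is identified with the set (or conjunction) of literals over $\tau$ it makes true. A formula (or set of formulas) $S$ defines $s$ if $S\equiv s$. For a literal $\ell$, the dual $\overline{\ell}$ is given by $\overline{p}=\neg p$, $\overline{\neg p}=p$. For sets of literals $\lambda\subseteq s$, $s\triangle\lambda := (s\setminus\lambda)\cup\{\overline{\ell}\mid\ell\in\lambda\}$. Size: $\mathrm{size}(\varphi)$ is the number of occurrences of proposition symbols in $\varphi$, i.e.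 $\mathrm{size}(\bot)=0$, $\mathrm{size}(p)=1$, $\mathrm{size}(\neg\alpha)=\mathrm{size}(\alpha)$, $\mathrm{size}(\alpha\land\beta)=\mathrm{size}(\alpha\lor\beta)=\mathrm{size}(\alpha)+\mathrm{size}(\beta)$. Literals are formulas $p$ or $\neg p$. A clause is a disjunction of literals, and a CNF formula is a conjunction of zero or more clauses (empty conjunction $=\top$). Counterfactual difference problem (propositional, CNF outputs). Input: $(S,\varphi,\psi)$ with $S\subseteq\mathrm{PL}[\tau]$ finite. Output: a triple $(\theta,\theta',\chi)$ of CNF formulas over $\tau$ such that 1. $S\equiv\theta\land\chi\vDash\varphi\land\neg\psi$ and $\theta'\land\chi\vDash\neg\varphi\land\psi$; 2. $\theta'\land\chi$ is satisfiable iff $S$ is satisfiable; 3. $\mathrm{size}(\theta)+\mathrm{size}(\theta')+\mathrm{size}(\chi)$ is minimal among all triples of CNF formulas satisfying 1 and 2; 4. as a secondary optimization criterion, $\mathrm{size}(\chi)$ is maximal among the triples satisfying 1–3. If no such triple exists, the output is $\mathtt{error}$. *)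

(* Defs.v *)
From mathcomp Require Import all_boot.
Set Implicit Arguments.
Unset Strict Implicit.
Unset Printing Implicit Defensive.

Inductive form (tau : Type) : Type :=
| FBot
| FVar of tau
| FNeg of form tau
| FAnd of form tau & form tau
| FOr of form tau & form tau.

Arguments FBot {tau}.

Definition FTop {tau : Type} : form tau := FNeg FBot.

Fixpoint fsize (tau : Type) (f : form tau) : nat :=
  match f with
  | FBot => 0
  | FVar _ => 1
  | FNeg a => fsize a
  | FAnd a b | FOr a b => fsize a + fsize b
  end.

Definition assignment (tau : finType) : Type := {ffun tau -> bool}.

Fixpoint sat (tau : finType) (s : assignment tau) (f : form tau) : bool :=
  match f with
  | FBot => false
  | FVar p => s p
  | FNeg a => ~~ sat s a
  | FAnd a b => sat s a && sat s b
  | FOr a b => sat s a || sat s b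
  end.

Definition entails (tau : finType) (f g : form tau) : Prop :=
  forall s : assignment tau, sat s f -> sat s g.

Definition equivalent (tau : finType) (f g : form tau) : Prop :=
  forall s : assignment tau, sat s f = sat s g.

Definition satisfiable (tau : finType) (f : form tau) : Prop :=
  exists s : assignment tau, sat s f.

(* Finite sets of formulas are given by an enumeration and are only ever used
   through the conjunction of their members. *)
Definition conj_of (tau : Type) (S : seq (form tau)) : form tau :=
  foldr (@FAnd tau) FTop S.

(* [(p, true)] encodes the literal p and [(p, false)] the literal ~p. *)
Definition literal (tau : finType) : finType := (tau * bool)%type.

Definition lit_form (tau : finType) (l : literal tau) : form tau :=
  if l.2 then FVar l.1 else FNeg (FVar l.1).

Definition dual (tau : finType) (l : literal tau) : literal tau :=
  (l.1, ~~ l.2).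

Definition lit_forms (tau : finType) (L : {set literal tau}) :
  seq (form tau) := [seq lit_form l | l <- enum L].

(* The set of literals with which an assignment is identified. *)
Definition true_lits (tau : finType) (s : assignment tau) :
  {set literal tau} := [set l | sat s (lit_form l)].

Definition defines (tau : finType) (f : form tau) (s : assignment tau) : Prop :=
  equivalent f (conj_of (lit_forms (true_lits s))).

Definition flip (tau : finType) (s la : {set literal tau}) :
  {set literal tau} := (s :\: la) :|: [set dual l | l in la].

Definition is_literal (tau : Type) (f : form tau) : bool :=
  match f with
  | FVar _ | FNeg (FVar _) => true
  | _ => false
  end.

(* Disjunctions and conjunctions are arbitrarily bracketed. Clauses contain at
   least one literal; the only empty conjunction is [FTop]. *)
Fixpoint is_clause (tau : Type) (f : form tau) : bool :=
  match f with
  | FOr a b => is_clause a && is_clause b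
  | _ => is_literal f
  end.

Fixpoint is_clause_conj (tau : Type) (f : form tau) : bool :=
  match f with
  | FAnd a b => is_clause_conj a && is_clause_conj b
  | _ => is_clause f
  end.

Definition is_cnf (tau : Type) (f : form tau) : bool :=
  match f with
  | FNeg FBot => true
  | _ => is_clause_conj f
  end.

Record triple (tau : Type) : Type := Triple {
  t_theta : form tau;
  t_theta' : form tau;
  t_chi : form tau
}.

Definition triple_size (tau : Type) (t : triple tau) : nat :=
  fsize (t_theta t) + fsize (t_theta' t) + fsize (t_chi t).

Definition cf_feasible (tau : finType) (S : seq (form tau))
    (phi psi : form tau) (t : triple tau) : Prop :=
  let: Triple theta theta' chi := t in
  [/\ [&& is_cnf theta, is_cnf theta' & is_cnf chi],
      equivalent (conj_of S) (FAnd theta chi),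
      entails (FAnd theta chi) (FAnd phi (FNeg psi)),
      entails (FAnd theta' chi) (FAnd (FNeg phi) psi) &
      satisfiable (FAnd theta' chi) <-> satisfiable (conj_of S)].

Definition cf_minimal (tau : finType) (S : seq (form tau))
    (phi psi : form tau) (t : triple tau) : Prop :=
  cf_feasible S phi psi t /\
  (forall u, cf_feasible S phi psi u -> triple_size t <= triple_size u).

Definition cf_solution (tau : finType) (S : seq (form tau))
    (phi psi : form tau) (t : triple tau) : Prop :=
  cf_minimal S phi psi t /\
  (forall u, cf_minimal S phi psi u -> fsize (t_chi u) <= fsize (t_chi t)).

(* [None] is the output error. *)
Definition cf_output (tau : finType) (S : seq (form tau))
    (phi psi : form tau) (o : option (triple tau)) : Prop :=
  match o with
  | Some t => cf_solution S phi psi t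
  | None => ~ exists t, cf_solution S phi psi t
  end.

Definition valid_flip (tau : finType) (s : assignment tau)
    (phi psi : form tau) (la : {set literal tau}) : Prop :=
  la \subset true_lits s /\
  entails (conj_of (lit_forms (flip (true_lits s) la))) (FAnd (FNeg phi) psi).

(* Main.v *)
Require Import Defs.
From mathcomp Require Import all_boot.
Set Implicit Arguments.
Unset Strict Implicit.
Unset Printing Implicit Defensive.

(** Let [t] be a model of [theta' /\ chi] at minimal Hamming distance from [s]
    and [D] the set of symbols on which they differ. Every literal true in [s]
    occurs in [theta /\ chi], since otherwise [s] could be toggled there; every
    literal true in [t] over a symbol of [D] occurs in [theta' /\ chi], since
    otherwise [t] could be moved closer to [s]. These are [#|tau| + #|D|]
    distinct literals, while any model of [~phi /\ psi] at distance [d] from [s]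
    yields a feasible triple of size [#|tau| + d]. Hence [#|D|] is minimal and
    each of the above literals occurs exactly once, and nothing else occurs.
    Resetting to [s] a second model of [theta' /\ chi] outside [D] keeps it a
    model, so it agrees with [t] on [D]. A disagreement at [p] outside [D]
    involves the clause [C] of [theta /\ chi] that breaks when [s] is toggled at
    [p]: if [C] is in [theta], moving it to [chi] enlarges [chi]; if [C] is in
    [chi], it has another literal, over some [q] in [D], occurring only there,
    and [t] toggled at [q] is a closer model. *)

Section Clauses.

Variable tau : finType.
Implicit Types (s t : assignment tau) (f g : form tau) (l : literal tau).
Implicit Types (c : seq (literal tau)) (cs : seq (seq (literal tau))).

(** * CNF formulas as lists of clauses, and back *)

Lemma sat_lit t l : sat t (lit_form l) = (t l.1 == l.2).
Proof. by case: l => p [] /=; case: (t p). Qed.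

Lemma in_true_lits t l : (l \in true_lits t) = (t l.1 == l.2).
Proof. by rewrite inE sat_lit. Qed.

(** Lists forget the bracketing and turn [fsize] into a count of literal occurrences. The value
    [[::]] is a default for formulas that are not clauses. *)
Fixpoint clause_lits f : seq (literal tau) :=
  match f with
  | FVar p => [:: (p, true)]
  | FNeg (FVar p) => [:: (p, false)]
  | FOr a b => clause_lits a ++ clause_lits b
  | _ => [::]
  end.

Fixpoint cnf_clauses f : seq (seq (literal tau)) :=
  match f with
  | FAnd a b => cnf_clauses a ++ cnf_clauses b
  | FNeg FBot => [::]
  | _ => [:: clause_lits f]
  end.

Definition clause_sat t c := has (fun l => t l.1 == l.2) c.
Definition clauses_sat t cs := all (clause_sat t) cs.

Lemma clause_litsP f : is_clause f ->
  [/\ forall t, sat t f = clause_sat t (clause_lits f),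
      fsize f = size (clause_lits f) & clause_lits f != [::]].
Proof.
elim: f => //= [p _|[] //= p _ _|a IHa b IHb /andP[/IHa[sa za na] /IHb[sb zb _]]].
- by split=> // t; rewrite /clause_sat /= orbF; case: (t p).
- by split=> // t; rewrite /clause_sat /= orbF; case: (t p).
split=> [t||]; first by rewrite sa sb /clause_sat has_cat.
  by rewrite size_cat za zb.
by case: (clause_lits a) na.
Qed.

Lemma clause_conjP f : is_clause_conj f ->
  [/\ forall t, sat t f = clauses_sat t (cnf_clauses f),
      fsize f = size (flatten (cnf_clauses f)) &
      [::] \notin cnf_clauses f].
Proof.
have single g : is_clause g ->
    [/\ forall t, sat t g = clauses_sat t [:: clause_lits g],
        fsize g = size (flatten [:: clause_lits g]) &
        [::] \notin [:: clause_lits g]].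
  move=> /clause_litsP[sg zg ng]; split=> [t||].
  - by rewrite sg /clauses_sat /= andbT.
  - by rewrite /= cats0.
  - by rewrite inE eq_sym.
elim: f => //= [p _|[] //= p _ _|a IHa b IHb|a IHa b IHb].
- exact: (single (FVar p)).
- exact: (single (FNeg (FVar p))).
- move=> /andP[/IHa[sa za na] /IHb[sb zb nb]]; split=> [t||].
  + by rewrite sa sb /clauses_sat all_cat.
  + by rewrite flatten_cat size_cat za zb.
  + by rewrite mem_cat negb_or na.
- exact: (single (FOr a b)).
Qed.

Lemma cnf_clausesP f : is_cnf f ->
  [/\ forall t, sat t f = clauses_sat t (cnf_clauses f),
      fsize f = size (flatten (cnf_clauses f)) &
      [::] \notin cnf_clauses f].
Proof.
case: f => [|p|[|p|f|a b|a b]|a b|a b] // h; exact: clause_conjP.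
Qed.

(** The fold starts from the first literal, since [is_clause] rejects a trailing [FBot]; [FBot] is
    only the value at the empty list. *)
Definition clause_form c : form tau :=
  if c is l :: c' then foldr (fun l' f => FOr (lit_form l') f) (lit_form l) c'
  else FBot.

Definition cnf_form cs : form tau :=
  if cs is c :: cs' then
    foldr (fun c' f => FAnd (clause_form c') f) (clause_form c) cs'
  else FTop.

Lemma clause_formP c : c != [::] ->
  [/\ forall t, sat t (clause_form c) = clause_sat t c,
      fsize (clause_form c) = size c & is_clause (clause_form c)].
Proof.
case: c => // l c _; elim: c => [|l' c [IHs IHz IHc]] /=.
  split=> [t||]; first by rewrite sat_lit /clause_sat /= orbF.
    by case: l => p [].
  by case: l => p [].
split=> [t||]; first by rewrite IHs sat_lit /clause_sat /= orbCA.
  by rewrite IHz /=; case: l' => p [].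
by rewrite IHc andbT; case: l' => p [].
Qed.

Lemma cnf_formP cs : [::] \notin cs ->
  [/\ forall t, sat t (cnf_form cs) = clauses_sat t cs,
      fsize (cnf_form cs) = size (flatten cs) & is_cnf (cnf_form cs)].
Proof.
have conj_cnf g : is_clause_conj g -> is_cnf g by case: g => // -[].
have clause_conj g : is_clause g -> is_clause_conj g by case: g.
case: cs => [|c cs] //; rewrite inE negb_or eq_sym => /andP[c0 cs0].
have [sc zc cc] := clause_formP c0.
(* The induction runs on [is_clause_conj]: [is_cnf] also accepts [FTop], which cannot be a
   conjunct. *)
suff [hs hz hc] : [/\ forall t, sat t (cnf_form (c :: cs)) = clauses_sat t (c :: cs),
      fsize (cnf_form (c :: cs)) = size (flatten (c :: cs)) &
      is_clause_conj (cnf_form (c :: cs))] by split=> //; exact: conj_cnf.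
elim: cs cs0 => [_|d cs IH] /=.
  by split=> [t||]; rewrite ?sc ?zc ?cats0 ?clause_conj // /clauses_sat /= andbT.
rewrite inE negb_or eq_sym => /andP[d0 /IH[IHs IHz IHc]].
have [sd zd cd] := clause_formP d0.
split=> [t||]; first by rewrite IHs sd /clauses_sat /= andbCA.
  by rewrite IHz zd /= !size_cat addnCA.
by rewrite IHc andbT clause_conj.
Qed.

(** * Changing an assignment at one symbol *)

Definition toggle t p : assignment tau := [ffun q => t q (+) (q == p)].

Definition diff s t : {set tau} := [set p | s p != t p].

Lemma clause_sat_mono t t' c :
  (forall l, l \in c -> t l.1 == l.2 -> t' l.1 == l.2) ->
  clause_sat t c -> clause_sat t' c.
Proof. by move=> h /hasP[l lc tl]; apply/hasP; exists l; rewrite ?h. Qed.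

Lemma clauses_sat_mono t t' cs :
  (forall l, l \in flatten cs -> t l.1 == l.2 -> t' l.1 == l.2) ->
  clauses_sat t cs -> clauses_sat t' cs.
Proof.
move=> h /allP tcs; apply/allP => c ccs; apply: clause_sat_mono (tcs c ccs).
by move=> l lc; apply: h; apply/flattenP; exists c.
Qed.

(** A clause without the literal of [t] at [p] keeps all its true literals after toggling, so a
    clause that breaks must contain that literal. *)
Lemma toggle_breaks t p cs :
  clauses_sat t cs -> ~~ clauses_sat (toggle t p) cs ->
  exists c, [/\ c \in cs, (p, t p) \in c & ~~ clause_sat (toggle t p) c].
Proof.
move=> /allP tcs /allPn[c ccs nc]; exists c; split=> //.
apply: contraR nc => ptc; apply: clause_sat_mono (tcs c ccs) => -[q b] /= lc tq.
rewrite ffunE; case: (q =P p) => [qp|_]; last by rewrite addbF.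
by move: ptc; rewrite -qp (eqP tq) lc.
Qed.

(** When no literal is repeated across the whole list, a literal determines the clause it lies
    in. *)
Lemma flatten_uniq_inj cs c d l : uniq (flatten cs) ->
  c \in cs -> d \in cs -> l \in c -> l \in d -> c = d.
Proof.
elim: cs => // e cs IH /=; rewrite cat_uniq => /and3P[_ /hasPn dis ucs].
rewrite !inE => /predU1P[->|cc] /predU1P[->|dd] lc ld //; last exact: IH.
  have /dis : l \in flatten cs by apply/flattenP; exists d.
  by rewrite /= lc.
have /dis : l \in flatten cs by apply/flattenP; exists c.
by rewrite /= ld.
Qed.

(** * Assignments as sets of literals, flips and their cardinalities *)

Lemma sat_conj_lits t (L : {set literal tau}) :
  sat t (conj_of (lit_forms L)) = (L \subset true_lits t).
Proof.
rewrite /lit_forms.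
have -> : sat t (conj_of [seq lit_form l | l <- enum L])
          = all (mem (true_lits t)) (enum L).
  by elim: (enum L) => //= l e ->; rewrite inE.
apply/allP/subsetP => h l; first by rewrite -mem_enum => /h.
by rewrite mem_enum => /h.
Qed.

Lemma sat_true_lits s t : sat t (conj_of (lit_forms (true_lits s))) = (t == s).
Proof.
rewrite sat_conj_lits; apply/subsetP/eqP => [h|-> //].
by apply/ffunP => p; apply/eqP; move: (h (p, s p)); rewrite !in_true_lits eqxx; apply.
Qed.

Lemma flip_diff s t :
  flip (true_lits s) [set l in true_lits s | l.1 \in diff s t] = true_lits t.
Proof.
apply/setP => -[p b]; rewrite !in_setU !in_setD !inE !sat_lit /=.
have -> : ((p, b) \in [set dual l | l in [set l in true_lits s | l.1 \in diff s t]])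
   = (s p != b) && (s p != t p).
  apply/imsetP/andP => [[[q c]]|[sb st]].
    rewrite !inE sat_lit /= => /andP[/eqP <- st] [-> ->]; split=> //.
    by case: (s q).
  exists (p, s p); first by rewrite !inE sat_lit eqxx.
  by rewrite /dual /=; case: b (s p) sb => -[].
by case: (s p) (t p) b => -[] [].
Qed.

Lemma card_flip_diff s t :
  #|[set l in true_lits s | l.1 \in diff s t]| = #|diff s t|.
Proof.
rewrite -(card_imset _ (_ : injective (fun p => (p, s p) : literal tau))); last first.
  by move=> p q [].
apply: eq_card => -[p b]; rewrite !inE sat_lit /=.
apply/andP/imsetP => [[/eqP <- pD]|[q]]; first by exists p; rewrite ?inE.
by rewrite inE => qD [-> ->].
Qed.

(** A subset of the true literals of [s] is determined by its symbols; [t] negates [s] exactly at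
    these. *)
Lemma flip_true_lits s (la : {set literal tau}) : la \subset true_lits s ->
  exists t, true_lits t = flip (true_lits s) la /\ #|diff s t| <= #|la|.
Proof.
move=> /subsetP las.
pose t : assignment tau := [ffun p => s p (+) ((p, s p) \in la)].
have la_diff : la = [set l in true_lits s | l.1 \in diff s t].
  apply/setP => -[p b]; rewrite !inE sat_lit /= ffunE.
  case: (s p =P b) => [<-|spb] /=; first by case: (s p) (_ \in _) => -[].
  by apply/negP => /las; rewrite in_true_lits => /eqP.
by exists t; rewrite -(flip_diff s t) -(card_flip_diff s t) -la_diff.
Qed.

(** Each symbol contributes its literal true in [s], and each symbol of disagreement also
    contributes the dual one. *)
Lemma card_true_litsU s t :
  #|true_lits s :|: true_lits t| = #|tau| + #|diff s t|.
Proof.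
have card_lits u (A : {set tau}) : #|[set ((p, u p) : literal tau) | p in A]| = #|A|.
  by apply: card_imset => p q [].
have -> : true_lits s :|: true_lits t =
    [set ((p, s p) : literal tau) | p in setT]
      :|: [set ((p, t p) : literal tau) | p in diff s t].
  apply/setP => -[p b]; rewrite !in_setU !in_true_lits /=.
  apply/orP/orP => [[/eqP <-|/eqP <-]|[/imsetP[q _ [-> ->]]|/imsetP[q _ [-> ->]]]].
  - by left; apply: imset_f.
  - case: (boolP (p \in diff s t)) => [pD|]; first by right; apply: imset_f.
    by rewrite inE negbK => /eqP <-; left; apply: imset_f.
  - by left.
  - by right.
rewrite cardsU !card_lits cardsT [X in _ - X](_ : _ = 0) ?subn0 //.
apply/eqP; rewrite cards_eq0 -subset0; apply/subsetP => l.
rewrite !inE => /andP[/imsetP[p _ ->] /imsetP[q qD [pq spt]]].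
by move: qD; rewrite inE -pq spt pq eqxx.
Qed.

(** * Construction of feasible triples *)

Lemma clauses_sat_units t (L : seq (literal tau)) :
  clauses_sat t [seq [:: l] | l <- L] = all (fun l => t l.1 == l.2) L.
Proof. by elim: L => //= l L <-; rewrite /clauses_sat /= {1}/clause_sat /= orbF. Qed.

Lemma all_lits_enum u t (A : {set tau}) :
  all (fun l => t l.1 == l.2) [seq ((p, u p) : literal tau) | p <- enum A]
  = [forall (p | p \in A), t p == u p].
Proof.
rewrite all_map; apply/allP/forall_inP => h p; last by rewrite mem_enum => /h.
by rewrite -mem_enum => /h.
Qed.

Definition cnf_triple (A B X : seq (seq (literal tau))) : triple tau :=
  Triple (cnf_form A) (cnf_form B) (cnf_form X).

Lemma cnf_triple_feasible s (phi psi : form tau) A B X t :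
  sat s (FAnd phi (FNeg psi)) ->
  [::] \notin A -> [::] \notin B -> [::] \notin X ->
  (forall u, clauses_sat u (A ++ X) = (u == s)) ->
  (forall u, clauses_sat u (B ++ X) -> sat u (FAnd (FNeg phi) psi)) ->
  clauses_sat t (B ++ X) ->
  cf_feasible (lit_forms (true_lits s)) phi psi (cnf_triple A B X).
Proof.
move=> sat_s /cnf_formP[sA _ cA] /cnf_formP[sB _ cB] /cnf_formP[sX _ cX] AX BX tBX.
have sAX u : sat u (FAnd (cnf_form A) (cnf_form X)) = (u == s).
  by rewrite -AX /clauses_sat all_cat /= sA sX.
have sBX u : sat u (FAnd (cnf_form B) (cnf_form X)) = clauses_sat u (B ++ X).
  by rewrite /clauses_sat all_cat /= sB sX.
split=> [|u|u|u|]; first by rewrite cA cB.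
- by rewrite sAX sat_true_lits.
- by rewrite sAX => /eqP ->.
- by rewrite sBX => /BX.
- by split=> _; [exists s; rewrite sat_true_lits | exists t; rewrite sBX].
Qed.

(** All clauses are units: [theta] and [theta'] list the literals of [s] and of [t] over [D], and
    [chi] lists the literals shared by both off [D]. The size is thus twice the cardinality of [D]
    plus that of its complement. *)
Lemma flip_triple_feasible s t (phi psi : form tau) :
  sat s (FAnd phi (FNeg psi)) -> sat t (FAnd (FNeg phi) psi) ->
  exists2 u, cf_feasible (lit_forms (true_lits s)) phi psi u &
    triple_size u = #|tau| + #|diff s t|.
Proof.
move=> sat_s sat_t; set D := diff s t.
pose units (u : assignment tau) (E : {set tau}) :=
  [seq [:: l] | l <- [seq ((p, u p) : literal tau) | p <- enum E]].
have nunits u E : [::] \notin units u E by apply/negP => /mapP[].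
have sat_units u v E : clauses_sat v (units u E) = [forall (p | p \in E), v p == u p].
  by rewrite clauses_sat_units all_lits_enum.
have size_units u E : fsize (cnf_form (units u E)) = #|E|.
  by have [_ -> _] := cnf_formP (nunits u E); rewrite flatten_seq1 size_map -cardE.
(* Applied below with [v] equal to [s] and to [t], which both agree with [s] off [D]. *)
have sat_split (u v : assignment tau) : (forall p, p \notin D -> v p = s p) ->
    clauses_sat u (units v D ++ units s (~: D)) = (u == v).
  move=> vs; rewrite /clauses_sat all_cat -!/(clauses_sat _ _) !sat_units.
  apply/andP/eqP => [[/forall_inP uD /forall_inP uC]|->].
    apply/ffunP => p; apply/eqP; case: (boolP (p \in D)) => pD; first exact: uD.
    by rewrite vs // uC // inE.
  by split; apply/forall_inP => p //; rewrite inE => /vs ->.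
have ts p : p \notin D -> t p = s p by rewrite inE negbK => /eqP.
exists (cnf_triple (units s D) (units t D) (units s (~: D))); last first.
  by rewrite /triple_size /= !size_units -(cardsC D) addnAC.
apply: (@cnf_triple_feasible _ _ _ _ _ _ t) => // [u|u|].
- by rewrite sat_split.
- by rewrite sat_split // => /eqP ->.
- by rewrite sat_split.
Qed.

End Clauses.

(** * Counting literal occurrences in an optimal triple *)

Theorem theorem4p7 (tau : finType) (s : assignment tau)
    (phi psi theta theta' chi : form tau) :
  satisfiable (FAnd (FNeg phi) psi) ->
  sat s (FAnd phi (FNeg psi)) ->
  cf_output (lit_forms (true_lits s)) phi psi
    (Some (Triple theta theta' chi)) ->
  exists s' : assignment tau,
    defines (FAnd theta' chi) s' /\
    exists la : {set literal tau},
      [/\ true_lits s' = flip (true_lits s) la,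
          valid_flip s phi psi la &
          forall la' : {set literal tau},
            valid_flip s phi psi la' -> #|la| <= #|la'|].
Proof.
move=> _ sat_s [[[/and3P[cA cB cX] eqS _ entB satB] min_size] max_chi].
have [sA zA nA] := cnf_clausesP cA; have [sB zB nB] := cnf_clausesP cB.
have [sX zX nX] := cnf_clausesP cX.
move: (cnf_clauses theta) (cnf_clauses theta') (cnf_clauses chi)
  => A B X in sA zA nA sB zB nB sX zX nX *.
have AX u : clauses_sat u (A ++ X) = (u == s).
  by rewrite -sat_true_lits eqS /= sA sX /clauses_sat all_cat.
have BXE u : sat u (FAnd theta' chi) = clauses_sat u (B ++ X).
  by rewrite /= sB sX /clauses_sat all_cat.
have BX u : clauses_sat u (B ++ X) -> sat u (FAnd (FNeg phi) psi).
  by rewrite -BXE => /entB.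
have [t0 t0BX] : exists t, clauses_sat t (B ++ X).
  have [|t tBX] := satB.2; first by exists s; rewrite sat_true_lits.
  by exists t; rewrite -BXE.
have [t tBX t_min] := @arg_minnP _ t0 (fun u => clauses_sat u (B ++ X))
  (fun u => #|diff s u|) t0BX.
set D := diff s t.
set N := flatten (A ++ B ++ X).
have sizeN : size N = triple_size (Triple theta theta' chi).
  by rewrite /triple_size /= zA zB zX /N !flatten_cat !size_cat addnA.
have flip_bound u : sat u (FAnd (FNeg phi) psi) -> size N <= #|tau| + #|diff s u|.
  by move=> /(flip_triple_feasible sat_s)[v fv <-]; rewrite sizeN min_size.
have s_toggle p : exists c,
    [/\ c \in A ++ X, (p, s p) \in c & ~~ clause_sat (toggle s p) c].
  apply: toggle_breaks; rewrite AX //; apply/eqP => /ffunP/(_ p).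
  by rewrite ffunE eqxx; case: (s p).
have t_toggle q : q \in D -> exists c,
    [/\ c \in B ++ X, (q, t q) \in c & ~~ clause_sat (toggle t q) c].
  move=> qD; apply: toggle_breaks => //; apply/negP => /t_min; apply/negP.
  (* Toggling at [q] in [D] removes [q] from the difference set and adds nothing. *)
  rewrite -ltnNge; apply/proper_card/properP; split.
    apply/subsetP => p; rewrite !inE ffunE; case: (p =P q) => [->|_]; last by rewrite addbF.
    by move: qD; rewrite inE.
  exists q => //; move: qD; rewrite !inE ffunE eqxx.
  by case: (s q) (t q) => -[].
have inN c l : c \in A ++ B ++ X -> l \in c -> l \in N.
  by move=> cN lc; apply/flattenP; exists c.
have AXN c : c \in A ++ X -> c \in A ++ B ++ X.
  by rewrite !mem_cat => /orP[->|->] //; rewrite !orbT.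
have BXN c : c \in B ++ X -> c \in A ++ B ++ X.
  by rewrite [in X in _ -> X]mem_cat => ->; rewrite orbT.
pose U := true_lits s :|: true_lits t.
have UN : {subset enum U <= N}.
  move=> [p b]; rewrite mem_enum in_setU !in_true_lits /= => spt.
  have [spb|spb] := eqVneq (s p) b.
    by have [c [/AXN cN pc _]] := s_toggle p; rewrite -spb; apply: inN pc.
  move: spt; rewrite (negbTE spb) /= => /eqP tpb; rewrite -tpb.
  have [|c [/BXN cN pc _]] := t_toggle p; first by rewrite inE tpb.
  exact: inN pc.
have sizeU : size N <= size (enum U).
  by rewrite -cardE card_true_litsU flip_bound // BX.
(* A duplicate-free list contained in [N] and at least as long as [N] forces [N] to be
   duplicate-free with the same members. *)
have uniqN : uniq N := leq_size_uniq (enum_uniq _) UN sizeU.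
have [_ eqUN] := uniq_min_size (enum_uniq _) UN sizeU.
have NU p b : (p, b) \in N -> (s p == b) || (t p == b).
  by rewrite -eqUN mem_enum in_setU !in_true_lits.
have notD p : p \notin D -> s p = t p by rewrite inE negbK => /eqP.
have eqD u p : clauses_sat u (B ++ X) -> p \in D -> u p = t p.
  move=> uBX pD; pose v : assignment tau := [ffun q => if q \in D then u q else s q].
  (* Off [D], the literals occurring in [N] are all true in [s], so resetting to [s] there makes no
     occurring literal false. *)
  have vBX : clauses_sat v (B ++ X).
    apply: clauses_sat_mono uBX => -[q b] /= /flattenP[c /BXN cN qc] uqb.
    rewrite ffunE; case: ifPn => // /notD sqt.
    by have := NU _ _ (inN _ _ cN qc); rewrite -sqt orbb.
  have vD : diff s v \subset D.
    by apply/subsetP => q; rewrite inE ffunE; case: ifPn => //; rewrite eqxx.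
  (* Minimality of [t] excludes a proper subset of [D]. Hence [u] and [t] both differ from [s] on
     [D], and with two truth values they coincide there. *)
  have /eqP vDE : diff s v == D by rewrite eqEcard vD t_min.
  have := pD; rewrite -{1}vDE !inE ffunE pD.
  by move: pD; rewrite inE; case: (s p) (t p) (u p) => -[] [].
have uniq_model u : clauses_sat u (B ++ X) -> u = t.
  move=> uBX; apply/ffunP => p.
  have [pD|/notD spt] := boolP (p \in D); first exact: eqD.
  apply/eqP/negPn/negP => utp.
  have [c [cAX pc nc]] := s_toggle p.
  move: (cAX); rewrite mem_cat => /orP[cA'|cX'].
    have [A1 [A2 defA]] : exists A1 A2, A = A1 ++ c :: A2.
      by case/splitPr: cA' => A1 A2; exists A1, A2.
    have c0 : c != [::] by case: (c) pc.
    have tc : clause_sat t c by apply/hasP; exists (p, s p) => //=; rewrite spt.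
    have nA' : [::] \notin A1 ++ A2.
      by move: nA; rewrite defA !mem_cat inE !negb_or => /and3P[-> _ ->].
    have ncX : [::] \notin c :: X by rewrite inE negb_or eq_sym c0.
    (* Moving [c] into [chi] keeps the total size. The strengthened [theta' /\ chi] stays
       satisfiable because [t] agrees with [s] at [p] and so satisfies [c]. *)
    pose t' := cnf_triple (A1 ++ A2) B (c :: X).
    have [_ zA' _] := cnf_formP nA'; have [_ zB' _] := cnf_formP nB.
    have [_ zX' _] := cnf_formP ncX.
    have feas : cf_feasible (lit_forms (true_lits s)) phi psi t'.
      apply: (@cnf_triple_feasible _ _ _ _ _ _ _ t) => // [v|v|].
      - by rewrite -AX defA /clauses_sat !all_cat /= andbCA -!andbA andbCA.
      - rewrite /clauses_sat all_cat /= => /and3P[vB _ vX].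
        by apply: BX; rewrite /clauses_sat all_cat vB.
      - by move: tBX; rewrite /clauses_sat !all_cat /= tc.
    have size_t' : triple_size t' = size N.
      rewrite /triple_size /= zA' zB' zX' /N defA !flatten_cat /= !size_cat.
      by rewrite -!addnA !(addnCA (size c)).
    have /max_chi : cf_minimal (lit_forms (true_lits s)) phi psi t'.
      by split=> // v /min_size; rewrite size_t' sizeN.
    rewrite /= zX' zX /= size_cat leqNgt -[X in X < _]add0n ltn_add2r.
    by rewrite lt0n size_eq0 c0.
  have /hasP[[q b] qc /= uqb] : clause_sat u c.
    by move/allP: uBX; apply; rewrite mem_cat cX' orbT.
  have cN := AXN _ cAX; have qN := NU _ _ (inN _ _ cN qc).
  (* At [p] the only literal in [N] is the one true in both [s] and [t], and [u] falsifies it. *)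
  have qp : q != p.
    apply/eqP => qp; move: qN.
    by rewrite qp spt orbb -(eqP uqb) qp eq_sym (negbTE utp).
  (* Otherwise [(q, b)] would keep [c] true after toggling [s] at [p]. *)
  have sqb : s q != b.
    apply: contra nc => /eqP sqb; apply/hasP; exists (q, b) => //=.
    by rewrite ffunE (negbTE qp) addbF sqb.
  have tqb : t q = b by apply/eqP; move: qN; rewrite (negbTE sqb).
  have [|c' [/BXN cN' qc' nc']] := t_toggle q; first by rewrite inE tqb.
  (* The clause broken by toggling [t] at [q] is [c] itself, yet [(p, s p)] still satisfies it, as
     [t p = s p] and [p] differs from [q]. *)
  rewrite tqb in qc'; rewrite (flatten_uniq_inj uniqN cN' cN qc' qc) in nc'.
  move/negP: nc'; apply; apply/hasP; exists (p, s p) => //=.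
  by rewrite ffunE [p == q]eq_sym (negbTE qp) addbF spt.
exists t; split.
  by move=> u; rewrite BXE sat_true_lits; apply/idP/eqP => [/uniq_model|->].
exists [set l in true_lits s | l.1 \in D]; split; first by rewrite flip_diff.
- split; first by apply/subsetP => l; rewrite inE => /andP[].
  by move=> u; rewrite flip_diff sat_true_lits => /eqP ->; exact: BX.
(* For a competitor leading to [u], the count of [U] is at most [size N], hence at most the size of
   the triple built from [u]; the common term [#|tau|] cancels. *)
move=> la [/flip_true_lits[u [<- du]] flip_u].
rewrite card_flip_diff (leq_trans _ du) // -(leq_add2l #|tau|).
rewrite -card_true_litsU cardE (leq_trans (uniq_leq_size (enum_uniq _) UN)) //.
by apply: flip_bound; apply: flip_u; rewrite sat_true_lits.
Qed.
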